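(* Let $\boldsymbol{y}=\boldsymbol{M}\boldsymbol{x}$, where $\boldsymbol{x}\in\mathbb{R}^n$ satisfies $\|\boldsymbol{x}\|_0=k$, $L=\{i:\boldsymbol{x}(i)\neq 0\}$ is the true support, and $\boldsymbol{M}\in\mathbb{R}^{m\times n}$ (with unit-norm columns) satisfies the RIP of order $2k$ with a constant $\delta\le 0.445$. Then the algorithms OLSR (run with cardinality $k$) and IOLSR (run either with target cardinality $k$ or with target residual $\epsilon_t=0$) yield perfect support reconstruction: the support $T$ they output satisfies $T=L$.
   Context: Notation. $\|\cdot\|$ is the Euclidean norm and $\|\boldsymbol{x}\|_0$ is the number of nonzero entries of $\boldsymbol{x}$. $\boldsymbol{m}_{(i)}$ is the $i$-th column (atom) of $\boldsymbol{M}$, with $\|\boldsymbol{m}_{(i)}\|=1$ for all $i$. For an index set $T$, $\boldsymbol{M}_T$ is the submatrix of the columns indexed by $T$, $P_T$ is the orthogonal projection onto the column span of $\boldsymbol{M}_T$, and $R_T=I-P_T$. RIP. $\boldsymbol{M}$ satisfies the RIP of order $s$ with constant $\delta\in(0,1)$ if $(1-\delta)\|\boldsymbol{v}\|^2\le\|\boldsymbol{M}_T\boldsymbol{v}\|^2\le(1+\delta)\|\boldsymbol{v}\|^2$ for all $T$ with $|T|=s$ and all $\boldsymbol{v}\in\mathbb{R}^s$. Contributions. For $i\notin T$ let $g(T,i)=\langle R_T\boldsymbol{m}_{(i)},\boldsymbol{y}\rangle^2/\|R_T\boldsymbol{m}_{(i)}\|^2$ (the decrease of the squared residual $\|R_T\boldsymbol{y}\|^2$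 when $i$ is added to $T$). For $j\in T$ let $\ell(T,j)=g(T\setminus\{j\},j)$ (the increase of the squared residual when $j$ is removed from $T$). OLS. Start from $T=\emptyset$; at each iteration add to $T$ an index $i\in\arg\max_{i\notin T}g(T,i)$. OLSR (input $\boldsymbol{M},\boldsymbol{y},k$). Run $k+1$ iterations of OLS to obtain $T$ with $|T|=k+1$ (if the OLS residual is already zero with $|T|\le k$, return that $T$). Then loop: choose $j\in\arg\min_{j\in T}\ell(T,j)$ and let $\ell_j=\ell(T,j)$; set $T\leftarrow T\setminus\{j\}$; choose $i\in\arg\max_{i\notin T}g(T,i)$; if $g(T,i)\le \ell_j$ stop (the removed atom cannot be replaced by one giving a strictly smaller residual), otherwise set $T\leftarrow T\cup\{i\}$ and repeat. Output $T$ and the least squares estimate $\hat{\boldsymbol{x}}=\boldsymbol{M}_T^\dagger\boldsymbol{y}$ (supported on $T$). IOLSR (input $\boldsymbol{M},\boldsymbol{y}$ and either a target cardinality $k$ or a target residual $\epsilon_t$). Start from $T=\emptyset$. While $|T|<k+1$ (cardinality version), respectively while $\|R_T\boldsymbol{y}\|^2>\epsilon_t$ (residual version): choose $i\in\arg\max_{i\notin T}g(T,i)$, set $T\leftarrow T\cup\{i\}$, choose $j\in\arg\min_{j\in T}\ell(T,j)$ (with $j=i$ if $i$ attains the minimum), and if $j\ne i$ set $T\leftarrow T\setminus\{j\}$. In the cardinality version, after the loop ends (with $|T|=k+1$) the last found index $j$ is removed from $T$, so that $|T|=k$. Output $T$ and $\hat{\boldsymbol{x}}=\boldsymbol{M}_T^\dagger\boldsymbol{y}$.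 All computations are in exact arithmetic. *)

(* Defs.v *)
From Stdlib Require Import Relation_Operators.
From mathcomp Require Import all_boot all_order all_algebra.
From mathcomp Require Import reals.

Set Implicit Arguments.
Unset Strict Implicit.
Unset Printing Implicit Defensive.

Import Order.TTheory GRing.Theory Num.Theory.
Local Open Scope ring_scope.

Section Vectors.
Variable R : realType.

Definition dot (p : nat) (u v : 'cV[R]_p) : R := \sum_i u i 0 * v i 0.

(* MathComp-Analysis puts the max norm on matrices, hence this definition. *)
Definition norm2 (p : nat) (u : 'cV[R]_p) : R := Num.sqrt (dot u u).

Definition supp (p : nat) (u : 'cV[R]_p) : {set 'I_p} := [set i | u i 0 != 0].

Definition norm0 (p : nat) (u : 'cV[R]_p) : nat := #|supp u|.

End Vectors.

Section Dictionary.
Variables (R : realType) (m n : nat) (M : 'M[R]_(m, n)).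

Definition unit_columns : Prop := forall i, norm2 (col i M) = 1.

Definition submatrix (T : {set 'I_n}) : 'M[R]_(m, #|T|) :=
  colsub (fun i : 'I_#|T| => enum_val i) M.

Definition RIP (s : nat) (delta : R) : Prop :=
  0 < delta < 1 /\
  forall T : {set 'I_n}, #|T| = s -> forall v : 'cV[R]_#|T|,
    (1 - delta) * norm2 v ^+ 2 <= norm2 (submatrix T *m v) ^+ 2
      <= (1 + delta) * norm2 v ^+ 2.

(* [proj_mx U V] acts on row vectors, projecting on the row space of U along
   that of V.  Here U has the columns of M_T as its rows, and the row space of
   [kermx M_T] is {u | u *m M_T = 0}, the orthogonal complement; the transpose
   acts on column vectors.  The columns of M_T may be linearly dependent. *)
Definition projP (T : {set 'I_n}) : 'M[R]_m :=
  (proj_mx <<(submatrix T)^T>>%MS (kermx (submatrix T)))^T.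

Definition projR (T : {set 'I_n}) : 'M[R]_m := 1%:M - projP T.

Variable y : 'cV[R]_m.

(* As x / 0 = 0, this is 0 when column i lies in the span of the columns in T:
   adding such an index does not change the residual. *)
Definition gain (T : {set 'I_n}) (i : 'I_n) : R :=
  dot (projR T *m col i M) y ^+ 2 / norm2 (projR T *m col i M) ^+ 2.

Definition loss (T : {set 'I_n}) (j : 'I_n) : R := gain (T :\ j) j.

Definition sqres (T : {set 'I_n}) : R := norm2 (projR T *m y) ^+ 2.

End Dictionary.

Definition is_argmax (R : realType) (n : nat) (A : {set 'I_n}) (f : 'I_n -> R)
    (i : 'I_n) : Prop :=
  i \in A /\ forall l, l \in A -> f l <= f i.

Definition is_argmin (R : realType) (n : nat) (A : {set 'I_n}) (f : 'I_n -> R)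
    (i : 'I_n) : Prop :=
  i \in A /\ forall l, l \in A -> f i <= f l.

(* The algorithms leave the choice among several maximisers (minimisers) open,
   so each is a nondeterministic transition system. *)
Inductive config (A : Type) (n : nat) : Type :=
| Running of A
| Output of {set 'I_n}.
Arguments Running {A n} _.
Arguments Output {A n} _.

(* Whatever choices are made, the run started at [c0] is finite, and where it
   can no longer be continued the algorithm has output L. *)
Definition always_outputs (A : Type) (n : nat)
    (step : config A n -> config A n -> Prop) (c0 : config A n)
    (L : {set 'I_n}) : Prop :=
  Acc (fun c' c => step c c') c0 /\
  forall c, clos_refl_trans_1n _ step c0 c ->
    (forall c', ~ step c c') -> c = Output L.

Section Algorithms.
Variables (R : realType) (m n : nat) (M : 'M[R]_(m, n)) (y : 'cV[R]_m).

(* [Ols T]: the initial k+1 iterations of OLS; [Replace T]: the loop. *)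
Inductive olsr_state : Type :=
| Ols of {set 'I_n}
| Replace of {set 'I_n}.

Inductive olsr_step (k : nat) :
    config olsr_state n -> config olsr_state n -> Prop :=
| olsr_exact (T : {set 'I_n}) :
    (#|T| <= k)%N -> sqres M y T = 0 ->
    olsr_step k (Running (Ols T)) (Output T)
| olsr_select (T : {set 'I_n}) i :
    (#|T| <= k)%N -> sqres M y T != 0 -> is_argmax (~: T) (gain M y T) i ->
    olsr_step k (Running (Ols T)) (Running (Ols (i |: T)))
| olsr_selected (T : {set 'I_n}) :
    #|T| = k.+1 ->
    olsr_step k (Running (Ols T)) (Running (Replace T))
| olsr_stop T i j :
    is_argmin T (loss M y T) j ->
    is_argmax (~: (T :\ j)) (gain M y (T :\ j)) i ->
    gain M y (T :\ j) i <= loss M y T j ->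
    olsr_step k (Running (Replace T)) (Output (T :\ j))
| olsr_replace T i j :
    is_argmin T (loss M y T) j ->
    is_argmax (~: (T :\ j)) (gain M y (T :\ j)) i ->
    loss M y T j < gain M y (T :\ j) i ->
    olsr_step k (Running (Replace T)) (Running (Replace (i |: (T :\ j)))).

Definition olsr_init : config olsr_state n := Running (Ols set0).

(* One pass through the loop body of IOLSR from T, ending with T' and with j
   as the last found index to remove. *)
Inductive iolsr_body (T : {set 'I_n}) : {set 'I_n} -> 'I_n -> Prop :=
| IolsrBody i j :
    is_argmax (~: T) (gain M y T) i ->
    is_argmin (i |: T) (loss M y (i |: T)) j ->
    (is_argmin (i |: T) (loss M y (i |: T)) i -> j = i) ->
    iolsr_body T (if j == i then i |: T else (i |: T) :\ j) j.

(* The state also records the last found index j, if any. *)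
Inductive iolsr_card_step (k : nat) :
    config ({set 'I_n} * option 'I_n) n ->
    config ({set 'I_n} * option 'I_n) n -> Prop :=
| iolsr_card_loop (T : {set 'I_n}) oj T' j :
    (#|T| < k.+1)%N -> iolsr_body T T' j ->
    iolsr_card_step k (Running (T, oj)) (Running (T', Some j))
| iolsr_card_end (T : {set 'I_n}) j :
    (k.+1 <= #|T|)%N ->
    iolsr_card_step k (Running (T, Some j)) (Output (T :\ j)).

Definition iolsr_card_init : config ({set 'I_n} * option 'I_n) n :=
  Running (set0, None).

Inductive iolsr_res_step (eps : R) :
    config {set 'I_n} n -> config {set 'I_n} n -> Prop :=
| iolsr_res_loop T T' j :
    eps < sqres M y T -> iolsr_body T T' j ->
    iolsr_res_step eps (Running T) (Running T')
| iolsr_res_end T :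
    sqres M y T <= eps ->
    iolsr_res_step eps (Running T) (Output T).

Definition iolsr_res_init : config {set 'I_n} n := Running set0.

End Algorithms.

Arguments olsr_init {n}.
Arguments iolsr_card_init {n}.
Arguments iolsr_res_init {n}.

(* Main.v *)
(** Let z = x - a be the coefficient error of the least squares estimate a on
T + j, where |T| = k and j is both a best atom to add to T and a cheapest one to
remove from T + j, and let g be its gain.  Unit columns give a_l^2 >= g for all
l in T + j and <m_i, R_T y>^2 <= g for all i outside T.  With B = L \ T, the
squared residual on T + j is a sum over B of terms z_i <m_i, R_T y>, minus g if
j is not in L, hence at most 1/2 sum_B (z_i^2 + g).  The RIP applied to z bounds
it below by (1 - delta) sum_B (z_i^2 + g), so that delta < 1/2 forces g = 0 and
T = L.  When z may have 2k+1 nonzero entries, one entry outside L is erased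
first.  Hence OLSR can only stop, and IOLSR can only grow past k atoms, at L;
every swap strictly decreases the residual, so the runs are finite. *)
Require Import Defs.
From mathcomp Require Import all_boot all_order all_algebra.
From mathcomp Require Import reals.
From mathcomp Require Import ring lra zify.
Set Implicit Arguments.
Unset Strict Implicit.
Unset Printing Implicit Defensive.
Import Order.TTheory GRing.Theory Num.Theory.
Local Open Scope ring_scope.

(** * Euclidean inner product of column vectors *)

Section DotProduct.
Variables (R : realType) (p : nat).
Implicit Types u v w : 'cV[R]_p.

Lemma dotE u v : dot u v = (u^T *m v) 0 0.
Proof. by rewrite mxE; apply: eq_bigr => i _; rewrite mxE. Qed.

Lemma dotC u v : dot u v = dot v u.
Proof. by apply: eq_bigr => i _; rewrite mulrC. Qed.

Lemma dotDl u v w : dot (u + v) w = dot u w + dot v w.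
Proof. by rewrite !dotE linearD mulmxDl mxE. Qed.

Lemma dotNl u v : dot (- u) v = - dot u v.
Proof. by rewrite !dotE linearN mulNmx mxE. Qed.

Lemma dotZl c u v : dot (c *: u) v = c * dot u v.
Proof. by rewrite !dotE linearZ /= -scalemxAl mxE. Qed.

Lemma dotBl u v w : dot (u - v) w = dot u w - dot v w.
Proof. by rewrite dotDl dotNl. Qed.

Lemma dotDr u v w : dot w (u + v) = dot w u + dot w v.
Proof. by rewrite !(dotC w) dotDl. Qed.

Lemma dotBr u v w : dot w (u - v) = dot w u - dot w v.
Proof. by rewrite !(dotC w) dotBl. Qed.

Lemma dotZr c u v : dot u (c *: v) = c * dot u v.
Proof. by rewrite !(dotC u) dotZl. Qed.

Lemma dot0l v : dot 0 v = 0.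
Proof. by rewrite dotE trmx0 mul0mx mxE. Qed.

Lemma dot0r v : dot v 0 = 0.
Proof. by rewrite dotC dot0l. Qed.

Lemma dot_ge0 u : 0 <= dot u u.
Proof. by apply: sumr_ge0 => i _; rewrite -expr2 sqr_ge0. Qed.

Lemma dot_eq0 u : (dot u u == 0) = (u == 0).
Proof.
apply/eqP/eqP => [/eqP|->]; last by rewrite dot0l.
rewrite psumr_eq0 => [|i _]; last by rewrite -expr2 sqr_ge0.
move/allP=> u0; apply/matrixP => i j; rewrite ord1 mxE; apply/eqP.
by have := u0 i (mem_index_enum _); rewrite /= mulf_eq0 orbb.
Qed.

Lemma sqr_norm2 u : norm2 u ^+ 2 = dot u u.
Proof. by rewrite sqr_sqrtr ?dot_ge0. Qed.

End DotProduct.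

(** * Coefficient vectors and their supports *)

Section Dictionary.
Variables (R : realType) (m n : nat) (M : 'M[R]_(m, n)).
Implicit Types (T S : {set 'I_n}) (a b z : 'cV[R]_n) (u v : 'cV[R]_m).

Lemma suppP a T : reflect (forall i, i \notin T -> a i 0 = 0) (supp a \subset T).
Proof.
apply: (iffP subsetP) => [sT i iT|aT i].
  by apply/eqP; apply: contraNT iT => ai; apply: sT; rewrite inE.
by rewrite inE; apply: contraNT => /aT ->.
Qed.

Lemma supp_delta (i : 'I_n) : supp (delta_mx i 0 : 'cV[R]_n) = [set i].
Proof.
apply/setP => l; rewrite !inE mxE eqxx andbT.
by case: (l == i); rewrite ?oner_eq0 // eqxx.
Qed.

Lemma suppD a b T : supp a \subset T -> supp b \subset T -> supp (a + b) \subset T.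
Proof.
by move=> /suppP sa /suppP sb; apply/suppP => i iT; rewrite mxE sa // sb // addr0.
Qed.

Lemma suppZ c a T : supp a \subset T -> supp (c *: a) \subset T.
Proof. by move=> /suppP sa; apply/suppP => i iT; rewrite mxE sa // mulr0. Qed.

Lemma suppB a b T : supp a \subset T -> supp b \subset T -> supp (a - b) \subset T.
Proof. by move=> sa sb; rewrite -scaleN1r; apply/suppD/suppZ. Qed.

Lemma eraseE a l i : i != l -> (a - a l 0 *: delta_mx l 0) i 0 = a i 0.
Proof. by move=> /negPf il; rewrite !mxE il mulr0 subr0. Qed.

Lemma supp_erase a l T :
  supp a \subset T -> supp (a - a l 0 *: delta_mx l 0) \subset T :\ l.
Proof.
move=> sa; apply/suppP => i; rewrite !inE negb_and negbK.
have [->|il] /= := eqVneq i l; first by rewrite !mxE !eqxx mulr1 subrr.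
by rewrite eraseE //; apply/suppP.
Qed.

(** Prepares the use of the RIP: typically [B] holds the missed atoms of the support and [A] the
    wrongly selected ones, whose entries a minimal loss bounds from below. *)
Lemma le_dot_disjoint z (A B : {set 'I_n}) c : [disjoint A & B] ->
  (forall l, l \in A -> c <= z l 0 ^+ 2) ->
  \sum_(i in B) z i 0 ^+ 2 + #|A|%:R * c <= dot z z.
Proof.
move=> dAB cA; rewrite /dot [leRHS](bigID (mem B)) /=.
apply: lerD; first by apply: ler_sum => i _; rewrite expr2.
rewrite [leRHS](bigID (mem A)) /= -[leLHS]addr0 lerD //; last first.
  by apply: sumr_ge0 => i _; rewrite -expr2 sqr_ge0.
rewrite mulr_natl -sumr_const [leRHS](eq_bigl (mem A)) => [|i /=].
  by apply: ler_sum => i iA; rewrite -expr2 cA.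
by case iA: (i \in A); rewrite ?andbF // (disjointFr dAB iA).
Qed.

Lemma dot_mulmx a v : dot (M *m a) v = \sum_i a i 0 * dot (col i M) v.
Proof.
rewrite dotE trmx_mul -mulmxA mxE; apply: eq_bigr => i _.
by rewrite !mxE; congr (_ * _); apply: eq_bigr => l _; rewrite !mxE.
Qed.

Lemma mulmx_delta (i : 'I_n) : M *m delta_mx i 0 = col i M.
Proof. by rewrite -colE. Qed.

Lemma dot_mulmx_supp0 T a v : supp a \subset T ->
  (forall l, l \in T -> dot (col l M) v = 0) -> dot (M *m a) v = 0.
Proof.
move=> /suppP sa ov; rewrite dot_mulmx big1 // => i _.
have [iT|iT] := boolP (i \in T); first by rewrite ov // mulr0.
by rewrite sa // mul0r.
Qed.

(** Zero padding: coefficients on every index set live in one space, where estimates can be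
    subtracted from [x]. *)
Definition expand T (v : 'cV[R]_#|T|) : 'cV[R]_n := submatrix 1%:M T *m v.

Lemma mulmx_expand T (v : 'cV[R]_#|T|) : M *m expand v = submatrix M T *m v.
Proof. by rewrite /expand mulmxA mulmx_colsub mulmx1. Qed.

Lemma supp_expand T (v : 'cV[R]_#|T|) : supp (expand v) \subset T.
Proof.
apply/suppP => i iT; rewrite mxE big1 // => t _; rewrite !mxE.
by case: eqP => [it|]; rewrite ?mul0r //; move: iT; rewrite it enum_valP.
Qed.

Lemma submatrix_rowsub T a : supp a \subset T ->
  submatrix M T *m rowsub (fun t : 'I_#|T| => enum_val t) a = M *m a.
Proof.
move=> /suppP sa; apply/matrixP => i j; rewrite !ord1 !mxE.
rewrite (bigID (mem T)) /= [X in _ + X]big1 ?addr0 => [|l lT]; last first.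
  by rewrite sa // mulr0.
by rewrite [RHS]big_enum_val; apply: eq_bigr => t _; rewrite !mxE.
Qed.

Lemma dot_rowsub T a : supp a \subset T ->
  dot (rowsub (fun t : 'I_#|T| => enum_val t) a)
      (rowsub (fun t : 'I_#|T| => enum_val t) a) = dot a a.
Proof.
move=> /suppP sa; rewrite /dot [RHS](bigID (mem T)) /=.
rewrite [X in _ = _ + X]big1 ?addr0 => [|l lT]; last by rewrite sa // mulr0.
by rewrite [RHS]big_enum_val; apply: eq_bigr => t _; rewrite !mxE.
Qed.

(** * Orthogonal projections onto spans of atoms *)

Lemma mul_trmx_submatrix T u :
  reflect (forall l, l \in T -> dot (col l M) u = 0) (u^T *m submatrix M T == 0).
Proof.
have uE t : (u^T *m submatrix M T) 0 t = dot (col (enum_val t) M) u.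
  by rewrite dotC mxE; apply: eq_bigr => i _; rewrite !mxE.
apply: (iffP eqP) => [uT l lT|uT].
  by rewrite -(enum_rankK_in lT lT) -uE uT mxE.
by apply/matrixP => i t; rewrite ord1 uE mxE uT ?enum_valP.
Qed.

(** A common row [w = D *m (submatrix M T)^T] with [w *m submatrix M T = 0] has [w *m w^T = 0], so
    it vanishes; rank-nullity gives fullness. Hence [proj_mx] splits every vector, even when the
    columns are dependent. *)
Lemma projP_complement T :
  let U := <<(submatrix M T)^T>>%MS in let K := kermx (submatrix M T) in
  (U :&: K)%MS = 0 /\ row_full (U + K)%MS.
Proof.
move=> U K; have cap0 : (U :&: K)%MS = 0.
  apply/eqP; rewrite -submx0; apply/row_subP => i; set w := row i _.
  have wUK : (w <= U :&: K)%MS by apply: row_sub.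
  move: wUK; rewrite sub_capmx genmxE => /andP[/submxP[D wD] /sub_kermxP wK].
  rewrite submx0 -trmx_eq0 -dot_eq0 dotE trmxK {2}wD trmx_mul trmxK mulmxA wK.
  by rewrite mul0mx mxE.
split=> //; rewrite /row_full; have := mxrank_sum_cap U K.
rewrite cap0 mxrank0 addn0 => ->; rewrite genmxE mxrank_tr mxrank_ker.
by rewrite subnKC // rank_leq_row.
Qed.

Lemma projP_span T v : exists2 a, supp a \subset T & projP M T *m v = M *m a.
Proof.
have : ((projP M T *m v)^T <= (submatrix M T)^T)%MS.
  by rewrite trmx_mul trmxK; apply: submx_trans (proj_mx_sub _ _ _) _; rewrite genmxE.
case/submxP => D /(congr1 trmx); rewrite trmxK trmx_mul trmxK => ->.
by exists (expand D^T); rewrite ?supp_expand // mulmx_expand.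
Qed.

Lemma dot_projR_in T v l : l \in T -> dot (col l M) (projR M T *m v) = 0.
Proof.
move: l; apply/mul_trmx_submatrix/eqP/sub_kermxP.
have [cap0 full] := projP_complement T.
rewrite mulmxBl mul1mx linearB /= trmx_mul trmxK.
(* The residual is the component along the kernel, that is, orthogonal to the selected atoms. *)
rewrite -[X in X - _](add_proj_mx cap0 (submx_full _ full)).
by rewrite addrAC subrr add0r proj_mx_sub.
Qed.

Lemma projR_decomp T v : exists2 a, supp a \subset T & v = projR M T *m v + M *m a.
Proof.
have [a sa Pa] := projP_span T v; exists a => //.
by rewrite -Pa mulmxBl mul1mx subrK.
Qed.

Lemma dot_span_projR T a v : supp a \subset T -> dot (M *m a) (projR M T *m v) = 0.
Proof. by move=> /dot_mulmx_supp0; apply=> l lT; rewrite dot_projR_in. Qed.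

(** The difference of two candidate residuals lies in the span of the atoms in [T] and is orthogonal
    to it. *)
Lemma projR_unique T v u a : supp a \subset T ->
  (forall l, l \in T -> dot (col l M) u = 0) -> v = u + M *m a ->
  projR M T *m v = u.
Proof.
move=> sa ou; have [b sb] := projR_decomp T v.
set r := projR M T *m v => vb va.
have ru : r - u = M *m (a - b).
  apply/eqP; rewrite mulmxBr subr_eq addrAC eq_sym subr_eq eq_sym.
  by rewrite -vb va addrC.
apply/eqP; rewrite -subr_eq0 -dot_eq0 dotBr {1 2}ru; apply/eqP.
by rewrite dot_span_projR ?suppB // (dot_mulmx_supp0 (suppB sa sb)) // subr0.
Qed.

Lemma projR_span T a : supp a \subset T -> projR M T *m (M *m a) = 0.
Proof.
by move=> sa; apply: (projR_unique sa) => [l _|]; rewrite ?dot0r ?add0r.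
Qed.

Lemma projR_id T u : (forall l, l \in T -> dot (col l M) u = 0) ->
  projR M T *m u = u.
Proof.
move=> ou; apply: (projR_unique (a := 0)) => //; last by rewrite mulmx0 addr0.
by apply/suppP => i _; rewrite mxE.
Qed.

(** [u] differs from its residual by an element of the span, which is orthogonal to every
    residual. *)
Lemma dot_projR T u v : dot (projR M T *m u) (projR M T *m v) = dot u (projR M T *m v).
Proof.
have [a sa {2}->] := projR_decomp T u.
by rewrite dotDl dot_span_projR // addr0.
Qed.

Lemma dot_projR_sym T u v : dot (projR M T *m u) v = dot u (projR M T *m v).
Proof. by rewrite dotC -dot_projR dotC dot_projR. Qed.

(** * Squared residuals and gains *)

Lemma sqresE y T : sqres M y T = dot (projR M T *m y) y.
Proof. by rewrite /sqres sqr_norm2 dot_projR dotC. Qed.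

Lemma gainE y T i : gain M y T i =
  dot (col i M) (projR M T *m y) ^+ 2 / dot (projR M T *m col i M) (projR M T *m col i M).
Proof. by rewrite /gain sqr_norm2 dot_projR_sym. Qed.

(** A Gram-Schmidt step: only the part [q] of column [i] orthogonal to the atoms in [T] is new. *)
Lemma projR_setU1 y T i :
  projR M (i |: T) *m y = projR M T *m y -
    (dot (col i M) (projR M T *m y) / dot (projR M T *m col i M) (projR M T *m col i M))
      *: (projR M T *m col i M).
Proof.
set r := projR M T *m y; set q := projR M T *m col i M.
set c := _ / _; have [a sa ya] := projR_decomp T y.
have [b sb ib] := projR_decomp T (col i M).
have siT d : supp d \subset T -> supp d \subset i |: T.
  by move/subset_trans; apply; apply: subsetUr.
(* [M *m b] is the span component of column [i], so [M *m (delta_mx i 0 - b)] equals [q]. *)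
apply: (projR_unique (a := a + c *: (delta_mx i 0 - b))).
- apply/suppD/suppZ/suppB; [exact: siT| |exact: siT].
  by rewrite supp_delta sub1set setU11.
- move=> l; rewrite in_setU1 => /orP[/eqP->|lT]; last first.
    by rewrite dotBr dotZr !dot_projR_in // mulr0 subrr.
  rewrite dotBr dotZr -[dot _ q]dot_projR -/q /c.
  (* If [q = 0], then [c = 0] by the convention on division, and column [i], lying in the span, is
     already orthogonal to the residual. *)
  have [q0|q0] := eqVneq (dot q q) 0; last by rewrite divfK // subrr.
  rewrite q0 mulr0 subr0 -dot_projR -/q.
  by move/eqP: q0; rewrite dot_eq0 => /eqP->; rewrite dot0l.
have bq : col i M - M *m b = q by rewrite {1}ib addrK.
by rewrite mulmxDr -scalemxAr mulmxBr mulmx_delta bq addrACA addNr addr0 -ya.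
Qed.

Lemma sqres_setU1 y T i : sqres M y (i |: T) = sqres M y T - gain M y T i.
Proof.
rewrite !sqresE projR_setU1 dotBl dotZl gainE.
by rewrite [dot (_ *m col i M) y]dot_projR_sym mulrAC -expr2.
Qed.

Lemma gain_ge0 y T i : 0 <= gain M y T i.
Proof. by rewrite gainE divr_ge0 ?sqr_ge0 ?dot_ge0. Qed.

(** Pairing the decomposition of [y] with [projR M T *m y] kills all atoms of [T]; what remains is
    compared with [sqres_setU1]. *)
Lemma coef_mul_dot_projR y T j a : supp a \subset j |: T ->
  y = projR M (j |: T) *m y + M *m a ->
  a j 0 * dot (col j M) (projR M T *m y) = gain M y T j.
Proof.
move=> sa ya.
suff : sqres M y T = sqres M y (j |: T) + a j 0 * dot (col j M) (projR M T *m y).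
  by rewrite sqres_setU1; lra.
rewrite [LHS]sqresE dotC {1}ya dotDl dot_mulmx (bigD1 j) //= big1 => [|i ij].
  rewrite addr0 -dot_projR_sym projR_id => [|l lT]; first by rewrite -sqresE.
  by rewrite dot_projR_in // inE lT orbT.
have [iT|iT] := boolP (i \in T); first by rewrite dot_projR_in // mulr0.
by rewrite (suppP _ _ sa) ?mul0r // !inE negb_or ij.
Qed.

(** * Bounds on gains and losses from unit columns *)

Hypothesis M_unit : unit_columns M.

Lemma dot_col i : dot (col i M) (col i M) = 1.
Proof. by rewrite -sqr_norm2 M_unit expr1n. Qed.

Lemma dot_projR_col_le1 T i : dot (projR M T *m col i M) (projR M T *m col i M) <= 1.
Proof.
rewrite -(dot_col i); have [a sa {3 4}->] := projR_decomp T (col i M).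
rewrite dotDl !dotDr dot_span_projR // [dot _ (M *m a)]dotC dot_span_projR //.
by rewrite addr0 add0r lerDl dot_ge0.
Qed.

(** The denominator of the gain is at most 1; if it is 0, both sides vanish. *)
Lemma sqr_dot_le_gain y T i : dot (col i M) (projR M T *m y) ^+ 2 <= gain M y T i.
Proof.
rewrite gainE -dot_projR; set q := projR M T *m col i M.
have [/eqP|q0] := eqVneq (dot q q) 0.
  by rewrite dot_eq0 => /eqP->; rewrite !dot0l expr0n mul0r.
have q_gt0 : 0 < dot q q by rewrite lt_def q0 dot_ge0.
by rewrite ler_pdivlMr // ler_piMr ?sqr_ge0 // dot_projR_col_le1.
Qed.

(** Removing [l] returns [a l 0 *: q] to the residual, where [q] is the part of column [l]
    orthogonal to the other atoms. *)
Lemma loss_coef y T l a : l \in T -> supp a \subset T ->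
  y = projR M T *m y + M *m a ->
  loss M y T l = a l 0 ^+ 2 *
    dot (projR M (T :\ l) *m col l M) (projR M (T :\ l) *m col l M).
Proof.
move=> lT sa ya; rewrite /loss gainE.
set q := projR M (T :\ l) *m col l M.
suff -> : dot (col l M) (projR M (T :\ l) *m y) = a l 0 * dot q q.
  have [->|q0] := eqVneq (dot q q) 0; first by rewrite mulr0 expr0n mul0r mulr0.
  by rewrite expr2 !mulrA mulfK // mulrAC -expr2.
have -> : projR M (T :\ l) *m y = projR M T *m y + a l 0 *: q.
  rewrite {1}ya mulmxDr projR_id => [|t /setD1P[_ tT]]; last exact: dot_projR_in.
  congr (_ + _); have sb : supp (a - a l 0 *: delta_mx l 0) \subset T :\ l.
    exact: supp_erase.
  have := projR_span sb; rewrite mulmxBr mulmxBr -scalemxAr mulmx_delta.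
  by rewrite -scalemxAr => /eqP; rewrite subr_eq0 => /eqP.
by rewrite dotDr dot_projR_in // add0r dotZr -dot_projR.
Qed.

Lemma loss_le_coef y T l a : l \in T -> supp a \subset T ->
  y = projR M T *m y + M *m a -> loss M y T l <= a l 0 ^+ 2.
Proof.
move=> lT sa ya; rewrite (loss_coef lT sa ya) ler_piMr ?sqr_ge0 //.
exact: dot_projR_col_le1.
Qed.

End Dictionary.

Lemma subset_of_card (I : finType) (S : {set I}) s :
  (#|S| <= s <= #|I|)%N -> exists2 T : {set I}, S \subset T & #|T| = s.
Proof.
elim: s => [|s IHs] /andP[Ss sI].
  by exists S => //; apply/eqP; rewrite -leqn0.
have [S_s|] := ltnP #|S| s.+1; last first.
  by exists S => //; apply/eqP; rewrite eqn_leq Ss.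
have [|T ST Ts] := IHs; first by rewrite -ltnS S_s ltnW.
have /card_gt0P[i] : (0 < #|~: T|)%N by rewrite cardsCs setCK Ts subn_gt0.
rewrite inE => iT; exists (i |: T); last by rewrite cardsU1 iT Ts.
exact: subset_trans ST (subsetUr _ _).
Qed.

(** * The recovery criterion under the RIP *)

Section SparseRecovery.
Variables (R : realType) (m n k : nat) (M : 'M[R]_(m, n)) (x : 'cV[R]_n).
Variable delta : R.
Hypotheses (le_2k_n : (2 * k <= n)%N) (M_unit : unit_columns M).
Hypotheses (M_RIP : RIP M (2 * k) delta) (delta_lt : delta < 1 / 2).
Hypothesis x_sparse : #|supp x| = k.
Local Notation y := (M *m x).
Local Notation L := (supp x).

(** The RIP speaks of exactly [2 * k] atoms, so a smaller support is first enlarged inside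
    ['I_n]. *)
Lemma RIP_lower z : (#|supp z| <= 2 * k)%N ->
  (1 - delta) * dot z z <= dot (M *m z) (M *m z).
Proof.
move=> z2k; have [|T zT T2k] := subset_of_card (S := supp z) (s := (2 * k)%N).
  by rewrite z2k card_ord.
have [_ /(_ T T2k (rowsub (fun t => enum_val t) z))/andP[+ _]] := M_RIP.
by rewrite !sqr_norm2 dot_rowsub // submatrix_rowsub.
Qed.

(** [x - a] has at most [2 * k] nonzero entries and is mapped to 0, so the RIP gives [x = a]; then
    [L] is contained in [T], and cardinality forces equality. *)
Lemma sqres_eq0_support (T : {set 'I_n}) :
  (#|T| <= k)%N -> sqres M y T = 0 -> T = L.
Proof.
have delta_lt' := delta_lt.
move=> Tk; rewrite /sqres sqr_norm2 => /eqP; rewrite dot_eq0 => /eqP r0.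
have [a sa] := projR_decomp M T y; rewrite r0 add0r => ya.
have sxa : supp (x - a) \subset L :|: T.
  by apply: suppB; [apply: subsetUl | apply: subset_trans sa (subsetUr _ _)].
have : (1 - delta) * dot (x - a) (x - a) <= 0.
  apply: le_trans (RIP_lower _) _; last first.
    by rewrite mulmxBr ya subrr dot0l.
  apply: leq_trans (subset_leq_card sxa) _.
  by rewrite cardsU (leq_trans (leq_subr _ _)) // x_sparse mul2n -addnn leq_add2l.
rewrite pmulr_rle0; last by lra.
move=> d0; have : x - a == 0 by rewrite -dot_eq0 eq_le d0 dot_ge0.
rewrite subr_eq0 => /eqP xa; apply/esym/eqP.
by rewrite eqEcard {1}xa sa x_sparse.
Qed.

Lemma sqres_support : sqres M y L = 0.
Proof. by rewrite /sqres sqr_norm2 projR_span // dot0l. Qed.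

(* Here [z] is the coefficient error of the least squares estimate on [j |: T]
   and [p i] the correlation of atom i with the residual on [T]. *)
Lemma coef_error_contradiction (T : {set 'I_n}) j z (p : 'I_n -> R) (g : R) :
  #|T| = k -> j \notin T -> T != L -> 0 < g ->
  supp z \subset L :|: (j |: T) ->
  (forall l, l \in j |: T -> dot (col l M) (M *m z) = 0) ->
  (forall l, l \in (j |: T) :\: L -> g <= z l 0 ^+ 2) ->
  (forall i, i \notin T -> p i ^+ 2 <= g) ->
  dot (M *m z) (M *m z) = \sum_(i in L :\: T) z i 0 * p i - g *+ (j \notin L) ->
  (#|L :\: T| = 1%N -> j \notin L -> M *m z = 0) ->
  False.
Proof.
have delta_lt' := delta_lt.
move=> Tk jT TL g_gt0 sz.
pose B := L :\: T; pose A := (j |: T) :\: L.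
rewrite -/B -/A => oz gA p_le; set e := dot _ _ => eE z_eq0.
have dAB : [disjoint A & B].
  rewrite disjoints_subset; apply/subsetP => l.
  by rewrite in_setC !in_setD => /andP[/negPf-> _]; rewrite andbF.
have cardTL : #|T :\: L| = #|B|.
  by apply/(@addnI #|T :&: L|); rewrite cardsID setIC cardsID Tk x_sparse.
have q_gt0 : (0 < #|B|)%N.
  rewrite lt0n; apply: contra TL => /eqP/cards0_eq/eqP; rewrite setD_eq0 => LT.
  by rewrite eq_sym eqEcard LT Tk x_sparse leqnn.
set Z := \sum_(i in B) z i 0 ^+ 2.
have Z_ge0 : 0 <= Z by apply: sumr_ge0 => i _; apply: sqr_ge0.
(* From [2 z p <= z^2 + p^2] and [p^2 <= g]. *)
have zp_le : \sum_(i in B) z i 0 * p i <= (Z + #|B|%:R * g) / 2.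
  rewrite mulr_natl -sumr_const -big_split mulr_suml; apply: ler_sum => i.
  rewrite in_setD => /andP[/p_le pg _] /=.
  by have := sqr_ge0 (z i 0 - p i); rewrite sqrrB; lra.
have qg_gt0 : 0 < #|B|%:R * g by rewrite mulr_gt0 // ltr0n.
(* For [j] in the support the RIP applies to [z] itself; with [W = |B| g] it gives
   [(1 - delta) (Z + W) <= (Z + W) / 2]. *)
have [jL|jL] := boolP (j \in L).
  have cardA : #|A| = #|B|.
    rewrite -cardTL; apply: eq_card => l; rewrite !in_setD in_setU1.
    by case: eqP => // ->; rewrite (negPf jT) jL.
  have : (1 - delta) * dot z z <= e.
    apply: RIP_lower; apply: leq_trans (subset_leq_card sz) _.
    have -> : L :|: (j |: T) = L :|: T.
      by rewrite setUA (setUidPl (B := [set j]) _) ?sub1set.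
    by rewrite cardsU (leq_trans (leq_subr _ _)) // x_sparse Tk mul2n addnn leqnn.
  have := le_dot_disjoint dAB gA; rewrite cardA -/Z.
  move: eE zp_le; rewrite jL subr0; clear -delta_lt' Z_ge0 qg_gt0.
  set S := \sum_(i in B) _; move: (_ * g) qg_gt0 (dot z z) => W W_gt0 D -> h1 h2 h3.
  have h4 : (1 - delta) * (Z + W) <= (1 - delta) * D by rewrite ler_pM2l //; lra.
  have h5 : 0 < (1 - delta - 1 / 2) * (Z + W) by apply: mulr_gt0; lra.
  lra.
(* Up to 2k+1 atoms may be involved: erase the smallest entry of z in A. *)
have jA : j \in A by rewrite in_setD in_setU1 eqxx jL.
have cardA : #|A| = #|B|.+1.
  rewrite (cardsD1 j A) jA -cardTL add1n; congr _.+1; apply: eq_card => l.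
  rewrite in_setD1 !in_setD in_setU1.
  by case: eqP => // ->; rewrite (negPf jT) andbF.
have [l lA min_l] := arg_minP (P := fun l => l \in A) (fun l => z l 0 ^+ 2) jA.
set a := z l 0 ^+ 2 in min_l; have ga : g <= a by apply: gA.
have [lL lT] : l \notin L /\ l \in j |: T by apply/andP; rewrite -in_setD.
(* Column [l] is a unit vector orthogonal to [M *m z], so the erasure adds exactly [a] to the
   squared norm; the remaining [|B|] entries in [A] have squares at least [a]. *)
have drop_l : (1 - delta) * (Z + #|B|%:R * a) <= e + a.
  pose z' := z - z l 0 *: delta_mx l 0.
  have -> : e + a = dot (M *m z') (M *m z').
    rewrite mulmxBr -scalemxAr mulmx_delta dotBl !dotBr !dotZl !dotZr.
    by rewrite [dot _ (col l M)]dotC oz // dot_col // -/e /a; ring.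
  apply: le_trans (RIP_lower _); last first.
    apply: leq_trans (subset_leq_card (supp_erase l sz)) _.
    have := cardsD1 l (L :|: (j |: T)); rewrite in_setU lT orbT add1n.
    rewrite -ltnS => <-; apply: leq_trans (leq_card_setU _ _) _.
    by rewrite cardsU1 jT Tk x_sparse mul2n -addnn add1n addnS.
  rewrite ler_pM2l; last by lra.
  have dAlB : [disjoint A :\ l & B] by exact: disjointWl (subsetDl _ _) dAB.
  have cardAl : #|A :\ l| = #|B|.
    by apply/eqP; rewrite -eqSS -cardA (cardsD1 l A) lA.
  have := le_dot_disjoint (z := z') dAlB (c := a); rewrite cardAl.
  rewrite (eq_bigr (fun i => z i 0 ^+ 2)) => [|i iB]; last first.
    rewrite eraseE //; apply: contraNneq lL => <-.
    by move: iB; rewrite in_setD => /andP[].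
  by apply=> t; rewrite in_setD1 => /andP[tl tA]; rewrite eraseE //; apply: min_l.
(* For |B| = 1 that bound is too weak, but then the residual on [j |: T] is 0
   and the entry in B can be erased as well. *)
have [q1|q_ge2] := leqP #|B| 1.
  have B1 : #|B| = 1%N by apply/eqP; rewrite eqn_leq q1.
  have Mz0 := z_eq0 B1 jL; have /eqP/cards1P[i Bi] := B1.
  have [iT iL] : i \notin T /\ i \in L.
    by apply/andP; rewrite -in_setD -/B Bi set11.
  have LiT : L \subset i |: T.
    apply/subsetP => t tL; rewrite in_setU1 -in_set1 -Bi in_setD tL andbT.
    by case: (t \in T).
  (* As [M *m z = 0], the erased vector has image [- z i 0 *: col i M], of squared norm [Z]. The
     factor 2 is [|A| = |B| + 1]. *)
  have drop_i : (1 - delta) * (2 * a) <= Z.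
    pose z' := z - z i 0 *: delta_mx i 0.
    have -> : Z = dot (M *m z') (M *m z').
      rewrite mulmxBr Mz0 sub0r -scalemxAr mulmx_delta dotNl dotC dotNl dotZl dotZr.
      by rewrite dot_col // /Z Bi big_set1; ring.
    apply: le_trans (RIP_lower _); last first.
      apply: leq_trans (subset_leq_card (supp_erase i sz)) _.
      apply: (@leq_trans #|j |: T|); last first.
        rewrite cardsU1 jT Tk mul2n -addnn leq_add2r -x_sparse.
        by apply/card_gt0P; exists i.
      apply/subset_leq_card/subsetP => t; rewrite in_setD1 => /andP[/negPf ti].
      rewrite in_setU => /orP[/(subsetP LiT)|//].
      by rewrite !in_setU1 ti => /= ->; rewrite orbT.
    rewrite ler_pM2l; last by lra.
    have dA0 : [disjoint A & (set0 : {set 'I_n})].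
      by rewrite disjoints_subset setC0 subsetT.
    have := le_dot_disjoint (z := z') dA0 (c := a).
    rewrite big_set0 add0r cardA B1; apply=> t tA; rewrite eraseE; first exact: min_l.
    by apply: contraTneq tA => ->; rewrite in_setD iL.
  have a_gt0 : 0 < a by lra.
  (* The two bounds combine to [(1 - delta) (1 + 2 (1 - delta)) a <= a], impossible for
     [delta < 1/2]. *)
  move: drop_l; rewrite /e Mz0 dot0l B1; clear -delta_lt' a_gt0 drop_i => drop_l.
  have h : 0 < (1 - delta - 1 / 2) * a by apply: mulr_gt0; lra.
  have h1 : (1 - delta) * ((1 - delta) * (2 * a)) <= (1 - delta) * Z.
    by rewrite ler_pM2l //; lra.
  have h2 : 0 < (1 - delta - 1 / 2) * ((1 - delta) * (2 * a)).
    by apply: mulr_gt0; [lra | apply: mulr_gt0; lra].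
  lra.
have q_ge2' : 2 <= #|B|%:R :> R by rewrite ler_nat.
move: eE drop_l zp_le q_ge2'; rewrite jL mulr1n.
move: (\sum_(i in B) _) (#|B|%:R) => S q -> drop_l zp_le q_ge2'.
clear -delta_lt' g_gt0 ga Z_ge0 drop_l zp_le q_ge2'.
(* This product is the slack when [(Z + q g) / 2 - g + a] is bounded by [(Z + q a) / 2]; its sign
   requires [q >= 2]. *)
have h1 : 0 <= (q / 2 - 1) * (a - g) by apply: mulr_ge0; lra.
have qa_gt0 : 0 < q * a by apply: mulr_gt0; lra.
have h2 : 0 < (1 - delta - 1 / 2) * (Z + q * a) by apply: mulr_gt0; lra.
lra.
Qed.

Lemma best_gain_least_loss_support (T : {set 'I_n}) j : #|T| = k -> j \notin T ->
  (forall i, i \notin T -> gain M y T i <= gain M y T j) ->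
  (forall l, l \in j |: T -> gain M y T j <= loss M y (j |: T) l) ->
  T = L.
Proof.
move=> Tk jT max_gain min_loss; apply/eqP/idPn => TL.
pose p i := dot (col i M) (projR M T *m y).
have p_le i : i \notin T -> p i ^+ 2 <= gain M y T j.
  by move=> iT; apply: le_trans (max_gain i iT); apply: sqr_dot_le_gain.
have resE : sqres M y T = \sum_(i in L :\: T) x i 0 * p i.
  rewrite sqresE dotC dot_mulmx [RHS]big_mkcond; apply: eq_bigr => i _.
  rewrite in_setD; have [iT|iT] /= := boolP (i \in T).
    by rewrite dot_projR_in // mulr0.
  by rewrite inE; case: eqP => [->|//]; rewrite mul0r.
(* A zero maximal gain would make every correlation outside [T] vanish, hence the residual on [T]
   too. *)
have g_gt0 : 0 < gain M y T j.
  rewrite lt_def gain_ge0 andbT; apply: contra TL => /eqP g0.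
  apply/eqP/sqres_eq0_support; rewrite ?Tk // resE big1 // => i.
  rewrite in_setD => /andP[/p_le]; rewrite g0 => pi0 _.
  have /eqP : p i ^+ 2 = 0 by apply: le_anti; rewrite pi0 sqr_ge0.
  by rewrite sqrf_eq0 => /eqP->; rewrite mulr0.
have [a sa yE] := projR_decomp M (j |: T) y.
have MzE : M *m (x - a) = projR M (j |: T) *m y by rewrite mulmxBr {1}yE addrK.
have sqE : dot (M *m (x - a)) (M *m (x - a)) = sqres M y T - gain M y T j.
  by rewrite MzE -sqres_setU1 /sqres sqr_norm2.
have a_out i : i != j -> i \notin T -> a i 0 = 0.
  by move=> ij iT; rewrite (suppP _ _ sa) // in_setU1 negb_or ij.
apply: (coef_error_contradiction (z := x - a) (p := p) Tk jT TL g_gt0) => //.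
- by apply: suppB; [apply: subsetUl | apply: subset_trans sa (subsetUr _ _)].
- by move=> l lT; rewrite MzE dot_projR_in.
- move=> l; rewrite in_setD inE negbK => /andP[/eqP xl0 lT].
  rewrite !mxE xl0 add0r sqrrN; apply: le_trans (min_loss l lT) _.
  exact: loss_le_coef.
(* If [j] is in [L], the gain equals [a j 0 * p j] and turns the term [x j 0 * p j] into
   [z j 0 * p j]; otherwise the sum has no term for [j] and the gain stays subtracted. *)
- rewrite sqE resE; have [jL|jL] := boolP (j \in L).
    have jB : j \in L :\: T by rewrite in_setD jT.
    rewrite subr0 -(coef_mul_dot_projR sa yE) -/(p j) !(bigD1 j jB) /= addrAC.
    rewrite -mulrBl; congr (_ * _ + _); first by rewrite !mxE.
    apply: eq_bigr => i /andP[iB ij];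
    have /andP[iT _] : (i \notin T) && (i \in L) by rewrite -in_setD.
    by rewrite !mxE a_out // subr0.
  congr (_ - _); apply: eq_bigr => i; rewrite in_setD => /andP[iT iL].
  by rewrite !mxE a_out ?subr0 //; apply: contraNneq jL => <-.
(* Adding the only missed atom [i] would annihilate the residual, and [j] gains at least as much. *)
- move=> /eqP/cards1P[i Bi] jL; apply/eqP; rewrite -dot_eq0 eq_le dot_ge0 andbT.
  have iT : i \notin T.
    by have := set11 i; rewrite -Bi in_setD => /andP[].
  rewrite sqE subr_le0; apply: le_trans (max_gain i iT).
  have LiT : L \subset i |: T.
    apply/subsetP => t tL; rewrite in_setU1 -in_set1 -Bi in_setD tL andbT.
    by case: (t \in T).
  by rewrite -subr_le0 -sqres_setU1 /sqres sqr_norm2 projR_span // dot0l.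
Qed.

End SparseRecovery.

(** The decreasing measure gives accessibility; progress leaves [Output L] as the only state in
    which a run can be stuck. *)
Lemma always_outputs_of_invariant (A : Type) n
    (step : config A n -> config A n -> Prop) (inv : config A n -> Prop)
    (mu : config A n -> nat) c0 L :
  inv c0 ->
  (forall c c', inv c -> step c c' -> inv c' /\ (mu c' < mu c)%N) ->
  (forall c, inv c -> c = Output L \/ exists c', step c c') ->
  always_outputs step c0 L.
Proof.
move=> inv0 inv_step progress; split.
  have [b] := ubnP (mu c0); elim: b c0 inv0 => [c _|b IHb c inv_c].
    by rewrite ltn0.
  rewrite ltnS => cb.
  constructor=> c' /(inv_step _ _ inv_c)[inv_c' c'c]; apply: IHb => //.
  exact: leq_trans c'c cb.
move=> c run; elim: run inv0 => {c0 c} [c inv_c stuck|c c' c'' cc' _ IH inv_c].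
  by case: (progress c inv_c) => // -[c' /stuck].
by apply: IH; case: (inv_step _ _ inv_c cc').
Qed.

(** * Existence of the choices made by the algorithms *)

Section Choices.
Variables (R : realType) (n : nat).
Implicit Types (A : {set 'I_n}) (f : 'I_n -> R).

Lemma argmax_exists A f i0 : i0 \in A -> exists i, is_argmax A f i.
Proof.
by move=> i0A; case: (arg_maxP (P := fun i => i \in A) f i0A) => i iA max_i; exists i.
Qed.

Lemma argmin_exists A f i0 : i0 \in A -> exists i, is_argmin A f i.
Proof.
by move=> i0A; case: (arg_minP (P := fun i => i \in A) f i0A) => i iA min_i; exists i.
Qed.

Lemma setC_gt0 A : (#|A| < n)%N -> exists i, i \in ~: A.
Proof. by move=> An; apply/card_gt0P; rewrite cardsCs setCK card_ord subn_gt0. Qed.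

End Choices.

(** Ranking turns a strict decrease among finitely many reals into one of natural numbers. *)
Lemma card_below_lt (R : realType) (I : finType) (f : I -> R) a b :
  f a < f b -> (#|[set s | (f s < f a)%R]| < #|[set s | (f s < f b)%R]|)%N.
Proof.
move=> ab; apply/proper_card/properP.
split; first by apply/subsetP => s; rewrite !inE => /lt_trans; apply.
by exists a; rewrite !inE ?ltxx.
Qed.

(** * Termination measure and the IOLSR loop body *)

Section Steps.
Variables (R : realType) (m n : nat) (M : 'M[R]_(m, n)) (y : 'cV[R]_m) (k : nat).
Implicit Types T : {set 'I_n}.

Lemma sqres_setD1 T j : j \in T -> sqres M y (T :\ j) = sqres M y T + loss M y T j.
Proof. by move=> jT; rewrite -{2}(setD1K jT) sqres_setU1 /loss subrK. Qed.

Lemma loss_setU1 T i : i \notin T -> loss M y (i |: T) i = gain M y T i.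
Proof. by move=> iT; rewrite /loss setU1K. Qed.

(* Lexicographic: first the number of atoms still to be added, then the rank of
   the squared residual among those of all index sets. *)
Definition height T : nat :=
  ((k.+1 - #|T|) * #|{set 'I_n}|.+1 + #|[set S | (sqres M y S < sqres M y T)%R]|)%N.

(** The weight of one missing atom exceeds every possible rank, so the residual rank may change
    freely. *)
Lemma height_setU1 T i : (#|T| <= k)%N -> i \notin T -> (height (i |: T) < height T)%N.
Proof.
move=> Tk iT; rewrite /height cardsU1 iT add1n subSS subSn // mulSn.
rewrite [X in (_ < X)%N]addnAC addnC ltn_add2r addSn ltnS.
by apply: leq_trans (leq_addr _ _); apply: max_card.
Qed.

Lemma height_lt T T' : #|T'| = #|T| -> sqres M y T' < sqres M y T ->
  (height T' < height T)%N.
Proof.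
move=> cardT lt_sq; rewrite /height cardT ltn_add2l; exact: card_below_lt.
Qed.

Lemma iolsr_body_exists T : (#|T| < n)%N -> exists T' j, iolsr_body M y T T' j.
Proof.
move=> /setC_gt0[i0 /(argmax_exists (gain M y T))[i max_i]].
have [j min_j] := argmin_exists (loss M y (i |: T)) (setU11 i T).
(* The tie rule imposes [i] when it attains the minimum and is vacuous otherwise. *)
have [ji|ij] := leP (loss M y (i |: T) i) (loss M y (i |: T) j).
  exists (if i == i then i |: T else (i |: T) :\ i), i; constructor=> //.
  by split=> [|l lT]; [exact: setU11 | apply: le_trans ji _; case: min_j => _; apply].
exists (if j == i then i |: T else (i |: T) :\ j), j; constructor=> // -[_ min_i].
by case: min_j => jT _; move: ij; rewrite ltNge min_i.
Qed.

End Steps.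

(** * Correctness of the three algorithms *)

Section Recovery.
Variables (R : realType) (m n k : nat) (M : 'M[R]_(m, n)) (x : 'cV[R]_n).
Variable delta : R.
Hypotheses (n_gt0 : (0 < n)%N) (le_2k_n : (2 * k <= n)%N) (M_unit : unit_columns M).
Hypotheses (M_RIP : RIP M (2 * k) delta) (delta_lt : delta < 1 / 2).
Hypothesis x_sparse : #|supp x| = k.
Local Notation y := (M *m x).
Local Notation L := (supp x).
Implicit Types T : {set 'I_n}.

Local Notation eq0_support := (sqres_eq0_support le_2k_n M_RIP delta_lt x_sparse).
Local Notation best_support :=
  (best_gain_least_loss_support le_2k_n M_unit M_RIP delta_lt x_sparse).

(** Ensures that a set of at most [k] atoms leaves one to add; [n_gt0] covers [k = 0]. *)
Lemma lt_sparsity_dim : (k < n)%N.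
Proof. by move: n_gt0 le_2k_n; lia. Qed.

(** If the new atom is kept, it is both a best addition and a cheapest removal, so the criterion
    applies at [k] atoms. Otherwise the tie rule makes the swap strictly profitable. *)
Lemma iolsr_body_cases T T' j : (#|T| <= k)%N -> iolsr_body M y T T' j ->
  [/\ T' = j |: T, j \notin T & (#|T| = k -> T = L)] \/
  (#|T'| = #|T| /\ sqres M y T' < sqres M y T).
Proof.
move=> Tk [i {}j [iT max_i] [jT min_j] tie]; rewrite in_setC in iT.
have [ji|ji] := eqVneq j i.
  left; subst j; split=> // cardT; apply: (best_support cardT iT) => l lT.
    by apply: max_i; rewrite in_setC.
  by rewrite -(loss_setU1 M y iT) min_j.
right; split.
  by have := cardsD1 j (i |: T); rewrite jT cardsU1 iT !add1n => -[].
have lt_ji : loss M y (i |: T) j < loss M y (i |: T) i.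
  rewrite ltNge; apply/negP => le_ij; move/eqP: ji; apply; apply: tie.
  by split=> [|l lT]; [exact: setU11 | apply: le_trans le_ij (min_j l lT)].
rewrite sqres_setD1 // sqres_setU1 -[ltRHS](subrK (gain M y T i)) ltrD2l.
by rewrite -loss_setU1.
Qed.

Lemma olsr_recovery : always_outputs (olsr_step M y k) olsr_init L.
Proof.
pose inv (c : config (olsr_state n) n) := match c return Prop with
  | Running (Ols T) => (#|T| <= k.+1)%N
  | Running (Replace T) => #|T| = k.+1
  | Output T => T = L end.
(* The offsets make the passage from [Ols T] to [Replace T], which keeps [T], a decrease as well. *)
pose mu (c : config (olsr_state n) n) := match c with
  | Running (Ols T) => (height M y k T).+2
  | Running (Replace T) => (height M y k T).+1
  | Output T => 0%N end.
have cardD1 T j : #|T| = k.+1 -> j \in T -> #|T :\ j| = k.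
  by move=> cardT jT; move: cardT; rewrite (cardsD1 j T) jT => -[].
apply: (@always_outputs_of_invariant _ _ _ inv mu); first by rewrite /= cards0.
  move=> c c' inv_c step; case: step inv_c => /=
    [T Tk T0|T i Tk _ [iT _]|T cardT|T i j [jT min_j] [_ max_i] le_ij
    |T i j [jT _] [iT _] lt_ji] inv_c.
  - by split=> //; apply: eq0_support.
  - rewrite in_setC in iT; split; first by rewrite cardsU1 iT.
    by rewrite !ltnS height_setU1.
  - by split.
  - split=> //.
    (* By the stopping test, the removed [j] is itself a best atom to add to [T :\ j], its gain
       there being its loss. *)
    have jTj : j \notin T :\ j by rewrite setD11.
    apply: (best_support (cardD1 _ _ inv_c jT) jTj) => l lT.
      by apply: le_trans le_ij; apply: max_i; rewrite in_setC.
    by move: lT; rewrite setD1K // => /min_j.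
  rewrite in_setC in iT.
  have cardT' : #|i |: (T :\ j)| = k.+1 by rewrite cardsU1 iT (cardD1 _ _ inv_c jT).
  split=> //; rewrite ltnS; apply: height_lt; first by rewrite cardT'.
  by rewrite sqres_setU1 sqres_setD1 // -addrA gtrDl subr_lt0.
case=> [[T|T]|T] /= inv_c; last by left; rewrite inv_c.
  right; have [Tk|] := leqP #|T| k; last first.
    move=> Tk; exists (Running (Replace T)).
    by apply/olsr_selected/eqP; rewrite eqn_leq inv_c Tk.
  have [T0|T0] := eqVneq (sqres M y T) 0.
    by exists (Output T); apply: olsr_exact.
  have [i0 i0T] := setC_gt0 (leq_ltn_trans Tk lt_sparsity_dim).
  have [i max_i] := argmax_exists (gain M y T) i0T.
  by exists (Running (Ols (i |: T))); apply: olsr_select.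
right; have /card_gt0P[j0 j0T] : (0 < #|T|)%N by rewrite inv_c.
have [j min_j] := argmin_exists (loss M y T) j0T.
have jTj : j \in ~: (T :\ j) by rewrite in_setC setD11.
have [i max_i] := argmax_exists (gain M y (T :\ j)) jTj.
have [le_ij|lt_ji] := leP (gain M y (T :\ j) i) (loss M y T j).
  by exists (Output (T :\ j)); exact: olsr_stop min_j max_i le_ij.
by exists (Running (Replace (i |: (T :\ j)))); exact: olsr_replace min_j max_i lt_ji.
Qed.

Lemma iolsr_card_recovery : always_outputs (iolsr_card_step M y k) iolsr_card_init L.
Proof.
(* More than [k] atoms occur only as [L] plus the last found index, which the final removal
   deletes. *)
pose inv (c : config ({set 'I_n} * option 'I_n) n) := match c return Prop with
  | Running (T, oj) =>
      (#|T| <= k)%N \/ exists j, [/\ oj = Some j, T = j |: L & j \notin L]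
  | Output T => T = L end.
pose mu (c : config ({set 'I_n} * option 'I_n) n) := match c with
  | Running (T, _) => (height M y k T).+1
  | Output T => 0%N end.
apply: (@always_outputs_of_invariant _ _ _ inv mu); first by left; rewrite cards0.
  move=> c c' inv_c step; case: step inv_c => /= [T oj T' j Tk body|T j Tk] inv_c.
    rewrite ltnS in Tk.
    case: (iolsr_body_cases Tk body) => [[-> jT TL]|[cardT' lt_sq]].
      split; last by rewrite ltnS height_setU1.
      have [cardT|/eqP cardT] := eqVneq #|T| k.
        by right; exists j; rewrite -(TL cardT).
      by left; rewrite cardsU1 jT ltn_neqAle Tk andbT; apply/eqP.
    by split; [left; rewrite cardT' | rewrite ltnS height_lt].
  split=> //; case: inv_c => [|[j' [[->] -> j'L]]]; first by rewrite leqNgt Tk.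
  by rewrite setU1K.
case=> [[T oj]|T] /= inv_c; last by left; rewrite inv_c.
right; case: inv_c => [Tk|[j [-> -> jL]]].
  have [T' [j body]] := iolsr_body_exists M y (leq_ltn_trans Tk lt_sparsity_dim).
  by exists (Running (T', Some j)); apply: iolsr_card_loop body; rewrite ltnS.
exists (Output ((j |: L) :\ j)); apply: iolsr_card_end.
by rewrite cardsU1 jL x_sparse.
Qed.

Lemma iolsr_res_recovery : always_outputs (iolsr_res_step M y 0) iolsr_res_init L.
Proof.
pose inv (c : config {set 'I_n} n) := match c return Prop with
  | Running T => (#|T| <= k)%N
  | Output T => T = L end.
pose mu (c : config {set 'I_n} n) := match c with
  | Running T => (height M y k T).+1
  | Output T => 0%N end.
apply: (@always_outputs_of_invariant _ _ _ inv mu); first by rewrite /= cards0.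
  move=> c c' inv_c step; case: step inv_c => /= [T T' j T_gt0 body|T T_le0] Tk.
    case: (iolsr_body_cases Tk body) => [[-> jT TL]|[cardT' lt_sq]].
      split; last by rewrite ltnS height_setU1.
      (* Growth from [k] atoms would start at [L], where the residual is already 0 and the loop test
         fails. *)
      rewrite cardsU1 jT ltn_neqAle Tk andbT; apply/eqP => /TL TL'.
      by move: T_gt0; rewrite TL' sqres_support ltxx.
    by split; [rewrite cardT' | rewrite ltnS height_lt].
  split=> //; apply: eq0_support => //; apply: le_anti; rewrite T_le0.
  exact: sqr_ge0.
case=> [T|T] /= inv_c; last by left; rewrite inv_c.
right; have [T_le0|T_gt0] := leP (sqres M y T) 0.
  by exists (Output T); apply: iolsr_res_end.
have [T' [j body]] := iolsr_body_exists M y (leq_ltn_trans inv_c lt_sparsity_dim).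
by exists (Running T'); apply: iolsr_res_loop body.
Qed.

End Recovery.

Theorem theorem3p1 (R : realType) (m n k : nat) (M : 'M[R]_(m, n))
    (x : 'cV[R]_n) (y : 'cV[R]_m) (L : {set 'I_n}) (delta : R)
    (n_gt0 : (0 < n)%N) (le_2k_n : (2 * k <= n)%N)
    (M_unit : unit_columns M)
    (x_sparse : norm0 x = k) (L_supp : L = supp x) (y_def : y = M *m x)
    (M_RIP : RIP M (2 * k) delta) (delta_le : delta <= 445 / 1000) :
  [/\ always_outputs (olsr_step M y k) olsr_init L,
      always_outputs (iolsr_card_step M y k) iolsr_card_init L
    & always_outputs (iolsr_res_step M y 0) iolsr_res_init L].
Proof.
have delta_lt : delta < 1 / 2 by lra.
rewrite L_supp y_def; split.
- exact: (olsr_recovery n_gt0 le_2k_n M_unit M_RIP delta_lt x_sparse).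
- exact: (iolsr_card_recovery n_gt0 le_2k_n M_unit M_RIP delta_lt x_sparse).
- exact: (iolsr_res_recovery n_gt0 le_2k_n M_unit M_RIP delta_lt x_sparse).
Qed.
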